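(* Let $(\chi_n)_{n\ge 1}$, $f$, $a$, $H$, $f^H$, $F$ and $b$ be as in the context. Let $l>0$ satisfy $$l<\min\{H-f^H,\;F(a)\}\qquad\text{and}\qquad l>b-f(b)=-F(b),$$ and assume in addition that $f(x)<x-l$ for all $x>H$. Then for any initial value $x_0\in[0,\infty)$, almost surely, the solution $(x_n)$ of $x_{n+1}=\max\{f(x_n)+l\chi_{n+1},0\}$, $n=0,1,2,\dots$, eventually belongs to the interval $(a,H)$ (i.e. $x_n\in(a,H)$ for all sufficiently large $n$).
   Context: $(\chi_n)_{n\ge1}$ is a sequence of independent identically distributed continuous real random variables with zero mean on a complete probability space, whose common density $\phi$ satisfies $\phi(x)>0$ for $x\in(-1,1)$ and $\phi(x)=0$ for $x\notin[-1,1]$. $f:[0,\infty)\to[0,\infty)$ is continuous, $f(0)=0$, $f(x)>0$ for $x>0$, and there are fixed positive numbers $a<H$ such that (1) $f^H:=\max_{x\in[0,H]}f(x)<H$; (2) $f(x)>f(a)>a$ for all $x\in(a,H]$. $F(x):=f(x)-x$ for $x\in[0,\infty)$, and $b:=\min\{\beta>0:\ F(\beta)=\min_{x\in[0,a]}F(x)\}$ (with $\beta$ ranging over $(0,a]$), which is assumed to exist. The initial value $x_0$ is deterministic. *)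

(* Defs.v *)
From HB Require Import structures.
From mathcomp Require Import all_boot all_order all_algebra finmap.
From mathcomp Require Import all_classical all_reals all_analysis.

Set Implicit Arguments.
Unset Strict Implicit.
Unset Printing Implicit Defensive.

Import Order.TTheory GRing.Theory Num.Theory.
Import numFieldNormedType.Exports.

Local Open Scope classical_set_scope.
Local Open Scope ring_scope.

Definition is_maximum (R : realType) (A : set R) (m : R) : Prop :=
  A m /\ ubound A m.

Definition is_minimum (R : realType) (A : set R) (m : R) : Prop :=
  A m /\ lbound A m.

Definition mutually_independent (d : measure_display) (T : measurableType d)
    (R : realType) (P : probability T R) (X : nat -> {RV P >-> R}) : Prop :=
  forall (J : {fset nat}) (B : nat -> set R),
    (forall i, measurable (B i)) ->
    P (\bigcap_(i in [set` J]) (X i @^-1` B i)) =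
    (\prod_(i <- J) P (X i @^-1` B i))%E.
Arguments mutually_independent {d T R} P X.

Definition identically_distributed (d : measure_display) (T : measurableType d)
    (R : realType) (P : probability T R) (X : nat -> {RV P >-> R}) : Prop :=
  forall (m n : nat) (B : set R), measurable B ->
    distribution P (X m) B = distribution P (X n) B.
Arguments identically_distributed {d T R} P X.

Definition has_density (d : measure_display) (T : measurableType d)
    (R : realType) (P : probability T R) (X : {RV P >-> R}) (phi : R -> R) :
    Prop :=
  [/\ measurable_fun setT phi, (forall x, 0 <= phi x) &
      forall B : set R, measurable B ->
        distribution P X B = (\int[lebesgue_measure]_(x in B) (phi x)%:E)%E].
Arguments has_density {d T R} P X phi.

Definition drift (R : realType) (f : R -> R) (x : R) : R := f x - x.

(* Main.v *)
(** With noise bounded by [l], the drift condition above [H] brings the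
    trajectory into [0, H] in finitely many steps, [0, H] is then never left,
    and (a, H) is absorbing because [f >= f a > a + l] there. On [0, a] the
    drift is at least [- (b - f b) > - l], so every noise value close enough to
    1 moves the state up by a fixed [delta > 0]; hence [N > a / delta]
    consecutive such values push it past [a]. Independence makes runs of length
    [N] occur after every time almost surely. *)
Require Import Defs.
From HB Require Import structures.
From mathcomp Require Import all_boot all_order all_algebra finmap.
From mathcomp Require Import all_classical all_reals all_analysis.
From mathcomp Require Import measurable_realfun ring lra zify.

Set Implicit Arguments.
Unset Strict Implicit.
Unset Printing Implicit Defensive.

Import Order.TTheory GRing.Theory Num.Theory.
Import numFieldNormedType.Exports.

Local Open Scope classical_set_scope.
Local Open Scope ring_scope.

(** * Deterministic estimates along a single trajectory *)

Lemma exceeds_of_increments (R : realType) (u : nat -> R) (c delta : R)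
    (N : nat) :
  (forall n, (n < N)%N -> u n <= c -> u n + delta <= u n.+1) ->
  c < u 0%N + N%:R * delta -> exists2 n, (n <= N)%N & c < u n.
Proof.
move=> incr cN; apply: contrapT => below.
have le_c n : (n <= N)%N -> u n <= c.
  by move=> nN; rewrite leNgt; apply/negP => cn; apply: below; exists n.
have lin n : (n <= N)%N -> u 0%N + n%:R * delta <= u n.
  elim: n => [|n IH] nN; first by rewrite mul0r addr0.
  have := incr n nN (le_c _ (ltnW nN)); have := IH (ltnW nN).
  rewrite -natr1; lra.
by have := lin _ (leqnn N); have := le_c _ (leqnn N); lra.
Qed.

Lemma exists_nat_mul_gt (R : realType) (c delta : R) :
  0 < delta -> exists N : nat, c < N%:R * delta.
Proof.
move=> delta_gt0; exists (Num.trunc (c / delta)).+1.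
by rewrite -ltr_pdivrMr//; exact: truncnS_gt.
Qed.

(** The predicate [good] stands for a favourable noise value, which keeps the argument pathwise. The
    run of [N] good steps is chosen from time [m.+1] on, when the states are already strictly below
    [H]. It starts at a nonnegative state, so remaining in [0, a] throughout would mean a gain of
    [N * delta], more than [a]. *)
Lemma eventually_trapped (R : realType) (x : nat -> R) (good : nat -> Prop)
    (a H delta : R) (N : nat) :
  (forall n, 0 <= x n) ->
  (exists n, x n <= H) ->
  (forall n, x n <= H -> x n.+1 < H) ->
  (forall n, a < x n <= H -> a < x n.+1) ->
  (forall n, good n -> x n <= a -> x n + delta <= x n.+1) ->
  a < N%:R * delta ->
  (forall m, exists k, forall j, (j < N)%N -> good (m + k + j)%N) ->
  \forall n \near \oo, a < x n < H.
Proof.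
move=> x_ge0 [m xm] belowS aboveS grow aN blocks.
have below n : (m < n)%N -> x n < H.
  elim: n => // n IH; rewrite ltnS leq_eqVlt => /orP[/eqP <-|/IH/ltW/belowS//].
  exact: belowS.
have [k goodk] := blocks m.+1.
have [|//|n nN an] := @exceeds_of_increments _ (fun n => x (m.+1 + k + n)%N)
    a delta N.
- by move=> n nN; rewrite addnS; apply/grow/goodk.
- by have := x_ge0 (m.+1 + k + 0)%N; lra.
exists (m.+1 + k + n)%N => // i /= /subnK <-.
elim: (i - _)%N => [|j IH]; first by rewrite add0n an below//; lia.
rewrite addSn below; last by lia.
by case/andP: IH => ai iH; rewrite aboveS// ai ltW.
Qed.

(** The trajectory never exceeds its initial value, so while above [H] it lives in a compact
    interval. There the continuous function [y - f y - l] has a positive minimum, and each step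
    descends by at least that amount. *)
Lemma enters_below (R : realType) (f : R -> R) (H l : R) (x e : nat -> R) :
  0 < H ->
  {within `[0, +oo[, continuous f} ->
  (forall y, 0 <= y -> 0 <= f y) ->
  0 < l ->
  (forall y, 0 <= y <= H -> f y + l < H) ->
  (forall y, H < y -> f y < y - l) ->
  (forall n, e n <= l) ->
  (forall n, 0 <= x n) ->
  (forall n, x n.+1 = Num.max (f (x n) + e n) 0) ->
  exists n, x n <= H.
Proof.
move=> H_gt0 f_cont f_ge0 l_gt0 f_le f_above e_le x_ge0 xS.
have [|Hx0] := leP (x 0%N) H; first by exists 0%N.
have xS_le n : x n.+1 <= f (x n) + l.
  (* The truncation at 0 is harmless because [f (x n) + l] is nonnegative. *)
  rewrite xS ge_max lerD2l e_le/=.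
  by have := f_ge0 _ (x_ge0 n); lra.
have x_le n : x n <= x 0%N.
  elim: n => // n IH; apply: (le_trans (xS_le n)).
  have [xnH|/f_above] := leP (x n) H; last by lra.
  by have := f_le (x n); rewrite x_ge0 xnH => /(_ isT); lra.
have h_cont : {within `[H, x 0%N], continuous (fun y => y - f y)}.
  have sub : `[H, x 0%N] `<=` `[0, +oo[.
    by move=> y /=; rewrite !in_itv/= andbT => /andP[Hy _]; lra.
  move=> y; apply: cvgB; last exact: continuous_subspaceW sub f_cont y.
  exact: (continuous_subspaceT (fun z => @cvg_id _ (nbhs z))).
have [c cI c_min] := EVT_min (ltW Hx0) h_cont.
(* The minimum may sit at the endpoint [H], which [f_above] does not cover; there the bound
   [f H + l < H] takes over. *)
have delta_gt0 : 0 < c - f c - l.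
  move: cI; rewrite in_itv/= le_eqVlt => /andP[/orP[/eqP <-|/f_above ?] _].
    by have := f_le H; rewrite lexx ltW// => /(_ isT); lra.
  by lra.
have [N HN] := exists_nat_mul_gt (x 0%N - H) delta_gt0.
(* The sign is reversed to turn the descent into increments; their non-strict threshold is why the
   compact interval includes [H]. *)
have [|//|n _ xnH] := @exceeds_of_increments _ (fun n => - x n) (- H)
    (c - f c - l) N.
- move=> n _; rewrite lerN2 => Hxn.
  have := c_min (x n); rewrite in_itv/= Hxn x_le => /(_ isT).
  by have := xS_le n; lra.
- by lra.
by exists n; lra.
Qed.

(** * Independence and long runs of favourable noise *)

Lemma measurable_block (d : measure_display) (T : measurableType d)
    (R : realType) (P : probability T R) (chi : nat -> {RV P >-> R})
    (B : set R) (N m : nat) : measurable B ->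
  measurable (\bigcap_(j in `I_N) (chi (m + j)%N @^-1` B)).
Proof.
move=> mB; apply: bigcap_measurableType => j _.
by rewrite -[X in measurable X]setTI; exact: measurable_funPT.
Qed.

(* [J] ranges over finite sets of later indices so that the induction on [K]
   can absorb the next block into it: P(E \ G) = P(E) - P(E /\ G). *)
Lemma prob_no_block (d : measure_display) (T : measurableType d)
    (R : realType) (P : probability T R) (chi : nat -> {RV P >-> R})
    (B : set R) (p : R) (N m K : nat) (J : {fset nat}) :
  mutually_independent P chi -> measurable B ->
  (forall n, P (chi n @^-1` B) = p%:E) ->
  (forall i, i \in J -> (m + K * N <= i)%N) ->
  P ((\bigcap_(k in `I_K)
        ~` \bigcap_(j in `I_N) (chi (m + k * N + j)%N @^-1` B)) `&`
     \bigcap_(i in [set` J]) (chi i @^-1` B)) =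
  ((1 - p ^+ N) ^+ K * p ^+ #|` J|)%:E.
Proof.
move=> indep mB pB; elim: K J => [|K IH] J J_ge.
  rewrite II0 bigcap_set0 setTI indep//.
  under eq_bigr do rewrite pB.
  by rewrite prodEFin expr0 mul1r big_const_seq count_predT iter_mulr_1.
rewrite IIS bigcap_setU bigcap_set1.
set E := (X in X `&` _ `&` _); set EJ := (X in _ `&` X).
set G := \bigcap_(j in `I_N) (chi (m + K * N + j)%N @^-1` B).
have mE : measurable E.
  by apply: bigcap_measurableType => k _; apply/measurableC/measurable_block.
have mEJ : measurable EJ.
  apply: bigcap_measurableType => j _.
  by rewrite -[X in measurable X]setTI; exact: measurable_funPT.
have mG : measurable G by exact: measurable_block.
have -> : P (E `&` ~` G `&` EJ) = (P (E `&` EJ) - P (E `&` EJ `&` G))%E.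
  rewrite setIAC -setDE; apply: measureD => //; first exact: measurableI.
  by rewrite ltey_eq fin_num_measure//; exact: measurableI.
(* The indices of block [K]. Intersecting with [G] amounts to enlarging [J] by [I], so the induction
   hypothesis evaluates both terms of the difference. *)
pose I := [fset i in iota (m + K * N) N]%fset.
have EJG : E `&` EJ `&` G =
    E `&` \bigcap_(i in [set` (J `|` I)%fset]) (chi i @^-1` B).
  rewrite -setIA; congr (_ `&` _); apply/seteqP; split=> w /=.
    move=> [wJ wG] i /=; rewrite inE => /orP[/wJ//|].
    rewrite !inE mem_iota => /andP[le_i lt_i].
    have := wG (i - (m + K * N))%N; rewrite /= subnKC//; apply; lia.
  move=> wJI; split=> [i iJ|j jN].
    by apply: wJI; rewrite /= inE iJ.
  by apply: wJI; rewrite /= !inE mem_iota; apply/orP; right; move: jN => /=; lia.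
have PJ : P (E `&` EJ) = ((1 - p ^+ N) ^+ K * p ^+ #|` J|)%:E.
  by apply: IH => i /J_ge; rewrite mulSn; lia.
have PJI : P (E `&` EJ `&` G) =
    ((1 - p ^+ N) ^+ K * p ^+ #|` (J `|` I)%fset|)%:E.
  rewrite EJG; apply: IH => i; rewrite !inE mem_iota => /orP[/J_ge|].
    by rewrite mulSn; lia.
  by case/andP.
(* [J] starts only after block [K], so it is disjoint from [I] and the exponents add up. *)
have cardJI : #|` (J `|` I)%fset| = (#|` J| + N)%N.
  rewrite cardfsU card_fseq undup_id ?iota_uniq// size_iota.
  have -> : (J `&` I)%fset = fset0.
    apply/fsetP => i; rewrite !inE mem_iota; apply/negP => /andP[/J_ge].
    by rewrite mulSn; lia.
  by rewrite cardfs0 subn0.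
by rewrite PJI PJ -EFinB cardJI exprD exprS; congr EFin; ring.
Qed.

(** For fixed [m], it is enough to look at the disjoint windows starting at [m + k * N]. The first
    [K] of them all fail with probability [(1 - p ^+ N) ^+ K], which tends to 0; countably many [m]
    then cost only a null set. *)
Lemma ae_blocks (d : measure_display) (T : measurableType d)
    (R : realType) (P : probability T R) (chi : nat -> {RV P >-> R})
    (B : set R) (p : R) (N : nat) :
  mutually_independent P chi -> measurable B ->
  0 < p -> (forall n, P (chi n @^-1` B) = p%:E) ->
  {ae P, forall w, forall m, exists k, forall j, (j < N)%N ->
    B (chi (m + k + j)%N w)}.
Proof.
move=> indep mB p_gt0 pB; apply: ae_foralln => m.
pose E K := \bigcap_(k in `I_K)
  ~` \bigcap_(j in `I_N) (chi (m + k * N + j)%N @^-1` B).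
have mE K : measurable (E K).
  by apply: bigcap_measurableType => k _; apply/measurableC/measurable_block.
have mEoo : measurable (\bigcap_K E K) by exact: bigcap_measurableType.
have p_le1 : p <= 1.
  rewrite -lee_fin -(pB 0%N) probability_le1//.
  by rewrite -[X in measurable X]setTI; exact: measurable_funPT.
have PE K : P (E K) = ((1 - p ^+ N) ^+ K)%:E.
  have := @prob_no_block _ _ _ _ _ _ _ N m K fset0 indep mB pB.
  rewrite cardfs0 expr0 mulr1 => <- //.
  by rewrite -/(E K) set_fset0 bigcap_set0 setIT.
have q_gt0 : 0 < p ^+ N by exact: exprn_gt0.
have q_le1 : p ^+ N <= 1 by apply: exprn_ile1 => //; exact: ltW.
exists (\bigcap_K E K); split => //; last first.
  move=> w /= nex K _ k kK wk; apply: nex; exists (k * N)%N => j jN.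
  exact: wk.
have fin : P (\bigcap_K E K) \is a fin_num by exact: fin_num_measure.
suff P_le0 : (P (\bigcap_K E K) <= 0)%E.
  by apply/eqP; rewrite eq_le measure_ge0 andbT.
rewrite -(fineK fin) lee_fin.
have q_cvg : (1 - p ^+ N) ^+ K @[K --> \oo] --> (0 : R).
  by apply: cvg_expr; rewrite ger0_norm; lra.
apply: (cvgr_to_ge q_cvg).
apply: nearW => K; rewrite -lee_fin fineK// -PE le_measure ?inE//.
by move=> w; apply.
Qed.

(** * Support of a law given by its density *)

Lemma density_gt0 (d : measure_display) (T : measurableType d)
    (R : realType) (P : probability T R) (X : {RV P >-> R}) (phi : R -> R)
    (u v : R) :
  has_density P X phi -> u < v -> (forall x, u < x < v -> 0 < phi x) ->
  (0 < P (X @^-1` `]u, v[))%E.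
Proof.
move=> [mphi phi_ge0 PX] uv phi_gt0.
(* Were the probability zero, the integral of the nonnegative [phi] would vanish and [phi] would be
   zero almost everywhere on the interval. *)
rewrite lt_neqAle measure_ge0 andbT; apply/eqP => P0.
have := PX `]u, v[%classic (measurable_itv _).
rewrite /distribution/= /pushforward -P0 => I0.
have mE : measurable_fun `]u, v[ (fun y : R => (phi y)%:E).
  by apply/measurable_EFinP; exact: measurable_funS mphi.
have [/(_ _)] := ae_eq_integral_abs lebesgue_measure (measurable_itv `]u, v[) mE.
rewrite [X in X = _](_ : _ = 0%E); last first.
  by rewrite [RHS]I0; apply: eq_integral => y _ /=; rewrite ger0_norm.
move=> /(_ erefl) [A [mA A0 sub]] _.
(* The null set [A] contains every point of the interval where [phi] is nonzero, hence the whole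
   interval, of length [v - u > 0]. *)
have : (lebesgue_measure (`]u, v[%classic : set R) <= lebesgue_measure A)%E.
  apply: le_measure; rewrite ?inE// => y /= yI; apply: sub => /= /(_ yI).
  move: yI; rewrite in_itv/= => /phi_gt0 + [phi0].
  by rewrite phi0 ltxx.
rewrite A0 lebesgue_measure_itv/= lte_fin uv -EFinB lee_fin; lra.
Qed.

Lemma density_ae_in (d : measure_display) (T : measurableType d)
    (R : realType) (P : probability T R) (X : {RV P >-> R}) (phi : R -> R)
    (A : set R) :
  has_density P X phi -> measurable A -> (forall x, ~ A x -> phi x = 0) ->
  {ae P, forall w, A (X w)}.
Proof.
move=> [_ _ PX] mA phi0; exists (X @^-1` ~` A); split => //.
- rewrite -[X in measurable X]setTI.
  by apply: measurable_funPT => //; exact: measurableC.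
- have := PX (~` A) (measurableC mA).
  rewrite /distribution/= /pushforward => ->.
  by apply: integral0_eq => y /= /phi0 ->.
Qed.

Theorem corollary1 (R : realType) (d : measure_display) (T : measurableType d)
  (P : probability T R) (hP : measure_is_complete P)
  (chi : nat -> {RV P >-> R}) (phi : R -> R)
  (chi_indep : mutually_independent P chi)
  (chi_id : identically_distributed P chi)
  (chi_mean : forall n, ('E_P[chi n] = 0)%E)
  (chi_density : forall n, has_density P (chi n) phi)
  (phi_gt0 : forall x, -1 < x < 1 -> 0 < phi x)
  (phi_eq0 : forall x, ~~ (-1 <= x <= 1) -> phi x = 0)
  (f : R -> R) (a H fH b l : R)
  (f_cont : {within `[0, +oo[, continuous f})
  (f_ge0 : forall x, 0 <= x -> 0 <= f x)
  (f0 : f 0 = 0)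
  (f_gt0 : forall x, 0 < x -> 0 < f x)
  (a_gt0 : 0 < a) (aH : a < H)
  (fH_max : is_maximum (f @` `[0, H]) fH)
  (fH_lt : fH < H)
  (f_gt_fa : forall x, a < x <= H -> f a < f x)
  (fa_gt : a < f a)
  (b_min : is_minimum
     [set beta | 0 < beta <= a /\
                 is_minimum (drift f @` `[0, a]) (drift f beta)] b)
  (l_gt0 : 0 < l)
  (l_lt : l < Num.min (H - fH) (drift f a))
  (l_gt : b - f b < l)
  (f_above : forall x, H < x -> f x < x - l) :
  forall x0 : R, 0 <= x0 ->
  forall x : nat -> T -> R,
    (forall w, x 0%N w = x0) ->
    (forall n w, x n.+1 w = Num.max (f (x n w) + l * chi n w) 0) ->
    {ae P, forall w, \forall n \near \oo, a < x n w < H}.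
Proof.
move=> x0 x0_ge0 x x_0 xS.
move: l_lt; rewrite lt_min => /andP[lH]; rewrite /drift => lFa.
have H_gt0 : 0 < H by lra.
have f_le y : 0 <= y <= H -> f y + l < H.
  move=> yH; suff : f y <= fH by lra.
  by apply: fH_max.2; exists y => //=; rewrite in_itv.
have F_ge y : 0 <= y <= a -> f b - b <= f y - y.
  move=> ya; have [[_ [_ +]] _] := b_min; apply.
  by exists y => //=; rewrite in_itv.
(* Half of the slack between [l] and [b - f b]: noise contributing at least [l - delta] still leaves
   a net gain of [delta] on [0, a]. *)
pose delta := (l - (b - f b)) / 2.
(* Above [1 - delta / l] the scaled noise is at least [l - delta]; the cap at -1 keeps []c, 1[]
   inside the region where [phi] is positive. *)
pose c := Num.max (1 - delta / l) (- 1).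
have delta_gt0 : 0 < delta by rewrite /delta; lra.
have c_lt1 : c < 1.
  rewrite gt_max; have : 0 < delta / l by exact: divr_gt0.
  by move=> ?; apply/andP; split; lra.
have c_geN1 : -1 <= c by rewrite le_max lexx orbT.
have c_good y : c < y -> l - delta <= l * y.
  rewrite gt_max => /andP[cy _].
  have -> : l - delta = l * (1 - delta / l) by field; lra.
  by rewrite ler_pM2l// ltW.
have [N aN] := exists_nat_mul_gt a delta_gt0.
pose B : set R := `]c, 1[%classic.
have mB : measurable B by exact: measurable_itv.
have PB_gt0 : (0 < P (chi 0%N @^-1` B))%E.
  apply: density_gt0 (chi_density 0%N) c_lt1 _ => y /andP[cy y1].
  by apply: phi_gt0; rewrite y1 (le_lt_trans c_geN1).
have mchiB : measurable (chi 0%N @^-1` B).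
  by rewrite -[X in measurable X]setTI; exact: measurable_funPT.
have PB n : P (chi n @^-1` B) = (fine (P (chi 0%N @^-1` B)))%:E.
  by rewrite fineK ?fin_num_measure//; exact: (chi_id n 0%N B mB).
have p_gt0 : 0 < fine (P (chi 0%N @^-1` B)).
  by rewrite fine_gt0// PB_gt0 ltey_eq fin_num_measure.
have chi_le1 : {ae P, forall w, forall n, -1 <= chi n w <= 1}.
  apply: ae_foralln => n.
  have /filterS : {ae P, forall w, `[-1, 1]%classic (chi n w)}.
    apply: density_ae_in (chi_density n) (measurable_itv _) _ => y.
    by rewrite /= in_itv => /negP; exact: phi_eq0.
  by apply=> w; rewrite /= in_itv.
have blocks := ae_blocks N chi_indep mB p_gt0 PB.
apply: filterS2 chi_le1 blocks => w chi1 blocks.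
have e_le n : - l <= l * chi n w <= l by have := chi1 n; nra.
have x_ge0 n : 0 <= x n w.
  by case: n => [|n]; rewrite ?x_0// xS le_max lexx orbT.
(* With indices starting at 0, [chi n] drives the step from [x n] to [x n.+1], so it decides whether
   [n] is good. *)
apply: (@eventually_trapped _ (x ^~ w) (fun n => B (chi n w)) a H delta N) => //.
- apply: (@enters_below _ f H l _ (fun n => l * chi n w)) => // n.
  by case/andP: (e_le n).
- move=> n xnH; rewrite xS gt_max H_gt0 andbT.
  by have := f_le (x n w); rewrite x_ge0 xnH => /(_ isT); have := e_le n; lra.
(* Here [f (x n w) > f a > a + l], so even the worst noise [- l] leaves the state above [a]. *)
- move=> n /f_gt_fa fa_lt; rewrite xS lt_max; apply/orP; left.
  by have := e_le n; lra.
- move=> n; rewrite /B/= in_itv/= => /andP[/c_good cn _] xna.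
  rewrite xS le_max; apply/orP; left.
  have := F_ge (x n w); rewrite x_ge0 xna => /(_ isT).
  by move: cn; rewrite /delta; lra.
Qed.
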